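(* Let $\Gamma$ be the $\mathbb{Z}$-periodic graph with one-element fundamental cell (vertex set $\mathbb{Z}$, with $n$ and $n+k$ joined with weight $w(k)$) whose weights are given for $k\ge 0$ by $$w(k)=\begin{cases}\frac{1}{4k}&\text{if }k=2^{n-1}\text{ for some integer }n\ge1,\\0&\text{otherwise,}\end{cases}$$ and $w(-k):=w(k)$. Then the Floquet eigenvalue function of $\mathcal{A}_\Gamma$ is continuous but not differentiable at any point $\theta$.
   Context: $(\mathcal{A}_\Gamma\psi)(n)=\sum_{k\in\mathbb{Z}}w(k)\psi(n+k)$ on $\ell^2(\mathbb{Z})$. As the fundamental cell has one vertex, the Floquet eigenvalue function is the scalar function $E(\theta)=\sum_{k\in\mathbb{Z}}w(k)e^{2\pi i k\theta}$ on $\mathbb{T}=\mathbb{R}/\mathbb{Z}$. *)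

(* Defs.v *)
From Stdlib Require Export Reals ZArith.
From Stdlib Require Import Lra Lia ClassicalEpsilon.
From Coquelicot Require Export Coquelicot.
Open Scope R_scope.

(* Z-periodic graph with one-element fundamental cell: the vertices are the
   integers, and [weight G k] is the weight of the edge joining n and n + k,
   for every n. *)
Record Zgraph := mkZgraph {
  weight : Z -> R;
  weight_sym : forall k : Z, weight (- k) = weight k
}.

Definition SeriesC (a : nat -> C) : C :=
  (Series (fun n => Re (a n)), Series (fun n => Im (a n))).

(* Two-sided series: the sum over k >= 0 plus the sum over k < 0.  Like
   [Series], it is total; the value is meaningful when both halves converge. *)
Definition SeriesZ (a : Z -> C) : C :=
  (SeriesC (fun n => a (Z.of_nat n)) + SeriesC (fun n => a (- Z.of_nat (S n))%Z))%C.

(* e^(2 pi i t) *)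
Definition expi2 (t : R) : C := (cos (2 * PI * t), sin (2 * PI * t)).

Definition adjacency (G : Zgraph) (psi : Z -> C) (n : Z) : C :=
  SeriesZ (fun k => (RtoC (weight G k) * psi (n + k)%Z)%C).

(* Functions on the torus R/Z are represented by their 1-periodic lifts to R. *)
Definition floquet_eigenvalue (G : Zgraph) (theta : R) : C :=
  SeriesZ (fun k => (RtoC (weight G k) * expi2 (IZR k * theta))%C).

Lemma expi2_plus (s t : R) : expi2 (s + t) = (expi2 s * expi2 t)%C.
Proof.
unfold expi2, Cmult; simpl.
rewrite Rmult_plus_distr_l, cos_plus, sin_plus.
f_equal; ring.
Qed.

Lemma expi2_period (t : R) (k : Z) : expi2 (t + IZR k) = expi2 t.
Proof.
assert (H : forall (s : R) (n : nat), expi2 (s + INR n) = expi2 s).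
{ intros s n; unfold expi2.
  replace (2 * PI * (s + INR n)) with (2 * PI * s + 2 * INR n * PI) by ring.
  now rewrite cos_period, sin_period. }
destruct (Z_le_gt_dec 0 k) as [Hk | Hk].
- rewrite <- (Z2Nat.id k Hk), <- INR_IZR_INZ; apply H.
- rewrite <- (H (t + IZR k) (Z.to_nat (- k))).
  rewrite INR_IZR_INZ, Z2Nat.id by lia.
  rewrite opp_IZR; f_equal; ring.
Qed.

Lemma floquet_eigenvalue_period (G : Zgraph) (theta : R) :
  floquet_eigenvalue G (theta + 1) = floquet_eigenvalue G theta.
Proof.
assert (H : forall k, expi2 (IZR k * (theta + 1)) = expi2 (IZR k * theta)).
{ intros k; rewrite <- (expi2_period (IZR k * theta) k); f_equal; ring. }
unfold floquet_eigenvalue, SeriesZ, SeriesC.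
f_equal; f_equal; apply Series_ext; intros n; now rewrite H.
Qed.

Lemma SeriesC_mult_r (a : nat -> C) (c : C) :
  ex_series (fun n => Re (a n)) -> ex_series (fun n => Im (a n)) ->
  SeriesC (fun n => (a n * c)%C) = (SeriesC a * c)%C.
Proof.
intros Hr Hi; destruct c as [x y].
unfold SeriesC, Cmult; simpl.
assert (Hs : forall u z, ex_series u -> ex_series (fun n : nat => u n * z)).
{ intros u z Hu; now apply ex_series_scal_r. }
f_equal.
- rewrite <- !Series_scal_r, <- Series_minus by (now apply Hs).
  now apply Series_ext.
- rewrite <- !Series_scal_r, <- Series_plus by (now apply Hs).
  now apply Series_ext.
Qed.

(* The plane wave of quasimomentum theta is a generalized eigenfunction of the
   adjacency operator, with eigenvalue [floquet_eigenvalue G theta]. *)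
Lemma adjacency_plane_wave (G : Zgraph) (theta : R) (n : Z) :
  ex_series (fun k => Rabs (weight G (Z.of_nat k))) ->
  adjacency G (fun m => expi2 (IZR m * theta)) n
  = (floquet_eigenvalue G theta * expi2 (IZR n * theta))%C.
Proof.
intros H.
assert (H' : ex_series (fun k => Rabs (weight G (- Z.of_nat (S k))))).
{ apply ex_series_incr_1 in H.
  apply ex_series_ext with (2 := H); intros k.
  now rewrite weight_sym. }
assert (Hc : forall (w t : nat -> R), ex_series (fun k => Rabs (w k)) ->
  ex_series (fun k => Re (RtoC (w k) * expi2 (t k))%C) /\
  ex_series (fun k => Im (RtoC (w k) * expi2 (t k))%C)).
{ intros w t Hw; split;
    apply (@ex_series_le R_AbsRing R_CompleteNormedModule _ (fun k => Rabs (w k)));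
    try exact Hw; intros k; unfold norm; simpl; unfold abs; simpl.
  - replace (w k * cos (2 * PI * t k) - 0 * sin (2 * PI * t k))
      with (w k * cos (2 * PI * t k)) by ring.
    rewrite Rabs_mult; apply Rle_trans with (Rabs (w k) * 1); [| lra].
    apply Rmult_le_compat_l; [apply Rabs_pos |].
    apply Rabs_le, COS_bound.
  - replace (w k * sin (2 * PI * t k) + 0 * cos (2 * PI * t k))
      with (w k * sin (2 * PI * t k)) by ring.
    rewrite Rabs_mult; apply Rle_trans with (Rabs (w k) * 1); [| lra].
    apply Rmult_le_compat_l; [apply Rabs_pos |].
    apply Rabs_le, SIN_bound. }
assert (He : forall k, (RtoC (weight G k) * expi2 (IZR (n + k) * theta))%C
  = (RtoC (weight G k) * expi2 (IZR k * theta) * expi2 (IZR n * theta))%C).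
{ intros k; rewrite plus_IZR, Rmult_plus_distr_r, expi2_plus; ring. }
unfold adjacency, floquet_eigenvalue, SeriesZ.
rewrite Cmult_plus_distr_r.
rewrite <- !SeriesC_mult_r by (apply Hc; assumption).
f_equal; unfold SeriesC; f_equal; apply Series_ext; intros k; now rewrite He.
Qed.

Definition dyadic_weight_nonneg (k : Z) : R :=
  if excluded_middle_informative (exists n : Z, (1 <= n)%Z /\ k = (2 ^ (n - 1))%Z)
  then 1 / (4 * IZR k) else 0.

Definition dyadic_weight (k : Z) : R := dyadic_weight_nonneg (Z.abs k).

Lemma dyadic_weight_sym (k : Z) : dyadic_weight (- k) = dyadic_weight k.
Proof. unfold dyadic_weight; now rewrite Z.abs_opp. Qed.

Definition dyadic_graph : Zgraph := mkZgraph dyadic_weight dyadic_weight_sym.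

(* Main.v *)
(* The eigenvalue function is half of W(x) = sum_m 2^-m cos(2 pi 2^m x), the
   borderline case ab = 1 of Weierstrass' function.  Let h = 2^-M and
   c_m = cos(2 pi 2^m x).  The fourth difference of W at x with step h only sees
   the frequencies m < M, since the others have period h, and it turns each
   cosine into 16 c_m sin(pi 2^m h)^4, so that
     2^M D4 W(x; h) = 16 sum_(i = 1..M) 2^i sin(pi / 2^i)^4 c_(M-i).
   If W were differentiable at x, the left side would tend to 0.  The weights
   are 2, 1 and then decrease at least like (2/9)^i, so |2 c_(n+1) + c_n| would
   eventually be smaller than 1/3, which makes |c_n| < 1/2 for all large n.
   This contradicts c_(n+1) = 2 c_n^2 - 1. *)

Require Import Defs.
From Stdlib Require Import Lra Lia ClassicalEpsilon.

(** * Reduction of the eigenvalue function to a lacunary cosine series *)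

(** The partial sum of [a] up to [n] is the partial sum of the dyadic subsequence up to
    [Nat.log2 n], and [Nat.log2 n] tends to infinity. *)
Lemma is_series_dyadic_support (a : nat -> R) (l : R) :
  (forall n, ~ (exists m, n = (2 ^ m)%nat) -> a n = 0) ->
  is_series (fun m => a (2 ^ m)%nat) l -> is_series a l.
Proof.
intros Ha Hl.
(* Index 0 is excluded because [Nat.log2 0 = 0], so the right side would already contain [a 1]. *)
assert (Hsum : forall n, (0 < n)%nat ->
  sum_n a n = sum_n (fun m => a (2 ^ m)%nat) (Nat.log2 n)).
{ intros n; induction n as [|n IH]; [lia |]; intros _.
  destruct n as [|n].
  - assert (H0 : a 0%nat = 0).
    { apply Ha; intros [m Hm]; assert (H := Nat.pow_nonzero 2 m); lia. }
    rewrite sum_Sn, sum_O, H0; simpl; rewrite sum_O; apply Rplus_0_l.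
  - rewrite sum_Sn, IH by lia.
    (* The logarithm jumps exactly at powers of two, which is exactly where a new term enters. *)
    destruct (Nat.log2_succ_or (S n)) as [H | H]; rewrite H.
    + destruct (Nat.log2_eq_succ_is_pow2 _ H) as [b Hb].
      rewrite sum_Sn, <- H, Hb, Nat.log2_pow2 by lia; reflexivity.
    + rewrite Ha; [apply Rplus_0_r |].
      rewrite <- Nat.log2_eq_succ_iff_pow2 by lia; lia. }
apply filterlim_ext_loc
  with (f := fun n => sum_n (fun m => a (2 ^ m)%nat) (Nat.log2 n)).
- exists 1%nat; intros n Hn; symmetry; apply Hsum; lia.
- apply (filterlim_comp _ _ _ Nat.log2 _ _ eventually); [| exact Hl].
  intros P [N HN]; exists (2 ^ N)%nat; intros n Hn; apply HN.
  rewrite <- (Nat.log2_pow2 N) by lia; now apply Nat.log2_le_mono.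
Qed.

Lemma Rabs_div_pow2_le (c : R) (m : nat) :
  Rabs c <= 1 -> Rabs (c / 2 ^ m) <= (/ 2) ^ m.
Proof.
intros Hc.
assert (H2 : 0 < / 2 ^ m) by (apply Rinv_0_lt_compat, pow_lt; lra).
unfold Rdiv; rewrite Rabs_mult, (Rabs_pos_eq (/ 2 ^ m)), pow_inv by lra; nra.
Qed.

Lemma ex_series_inv_pow2 : ex_series (fun m => (/ 2) ^ m).
Proof. apply ex_series_geom; rewrite Rabs_pos_eq; lra. Qed.

Lemma ex_series_Rabs_div_pow2 (c : nat -> R) :
  (forall m, Rabs (c m) <= 1) -> ex_series (fun m => Rabs (c m / 2 ^ m)).
Proof.
intros Hc.
apply (@ex_series_le R_AbsRing R_CompleteNormedModule)
  with (2 := ex_series_inv_pow2).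
intros m; change (Rabs (Rabs (c m / 2 ^ m)) <= (/ 2) ^ m).
rewrite Rabs_Rabsolu; apply Rabs_div_pow2_le, Hc.
Qed.

Lemma Rabs_cos_le_1 (x : R) : Rabs (cos x) <= 1.
Proof. apply Rabs_le, COS_bound. Qed.

(** This is the function W of the proof idea. *)
Definition lacunary_cos (x : R) : R :=
  Series (fun m => cos (2 * PI * (2 ^ m * x)) / 2 ^ m).

Lemma dyadic_weight_pow2 (m : nat) :
  dyadic_weight (Z.of_nat (2 ^ m)) = / 4 * / 2 ^ m.
Proof.
unfold dyadic_weight, dyadic_weight_nonneg.
rewrite Z.abs_eq by lia.
destruct (excluded_middle_informative _) as [H | H].
- rewrite <- INR_IZR_INZ, pow_INR; change (INR 2) with 2.
  field; apply pow_nonzero; lra.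
- contradict H; exists (Z.of_nat m + 1)%Z; split; [lia |].
  replace (Z.of_nat m + 1 - 1)%Z with (Z.of_nat m) by lia.
  now rewrite Nat2Z.inj_pow.
Qed.

Lemma dyadic_weight_not_pow2 (k : nat) :
  ~ (exists m, k = (2 ^ m)%nat) -> dyadic_weight (Z.of_nat k) = 0.
Proof.
intros Hk; unfold dyadic_weight, dyadic_weight_nonneg.
rewrite Z.abs_eq by lia.
destruct (excluded_middle_informative _) as [[n [Hn He]] | H]; [| reflexivity].
contradict Hk; exists (Z.to_nat (n - 1)).
apply Nat2Z.inj; rewrite Nat2Z.inj_pow, Z2Nat.id by lia; exact He.
Qed.

(** The terms at k and -k are conjugate: the sines cancel and the cosines double, turning the factor
    1/4 into 1/2. *)
Lemma floquet_dyadic_graph (theta : R) :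
  floquet_eigenvalue dyadic_graph theta = RtoC (/ 2 * lacunary_cos theta).
Proof.
set (w := fun k => dyadic_weight (Z.of_nat k)).
assert (Hser : forall t : nat -> R,
  ex_series (fun m => t (2 ^ m)%nat / 2 ^ m) ->
  is_series (fun k => w k * t k) (/ 4 * Series (fun m => t (2 ^ m)%nat / 2 ^ m))).
{ intros t Ht; apply is_series_dyadic_support.
  - intros n Hn; unfold w; rewrite dyadic_weight_not_pow2 by exact Hn; ring.
  - apply is_series_ext
      with (a := fun m => scal (/ 4) (t (2 ^ m)%nat / 2 ^ m)).
    + intros m; unfold w; rewrite dyadic_weight_pow2.
      change (/ 4 * (t (2 ^ m)%nat / 2 ^ m) = / 4 * / 2 ^ m * t (2 ^ m)%nat).
      unfold Rdiv; ring.
    + exact (is_series_scal (V := R_NormedModule) (/ 4) _ _ (Series_correct _ Ht)). }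
assert (Hw0 : w 0%nat = 0).
{ apply dyadic_weight_not_pow2; intros [m Hm].
  assert (H := Nat.pow_nonzero 2 m); lia. }
(* The negative half starts at k = -1; since [w 0] vanishes, it can be compared with the full
   nonnegative half. *)
assert (Htail : forall t : nat -> R, ex_series (fun k => w k * t k) ->
  Series (fun k => w (S k) * t (S k)) = Series (fun k => w k * t k)).
{ intros t Ht; rewrite (Series_incr_1 _ Ht), Hw0; ring. }
set (tc := fun k : nat => cos (2 * PI * (INR k * theta))).
set (ts := fun k : nat => sin (2 * PI * (INR k * theta))).
assert (Hc : is_series (fun k => w k * tc k) (/ 4 * lacunary_cos theta)).
{ replace (lacunary_cos theta) with (Series (fun m => tc (2 ^ m)%nat / 2 ^ m)).
  - apply Hser, ex_series_Rabs, ex_series_Rabs_div_pow2; intros k; apply Rabs_cos_le_1.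
  - apply Series_ext; intros m; unfold tc.
    now rewrite pow_INR. }
assert (Hs : ex_series (fun k => w k * ts k)).
{ eexists; apply Hser, ex_series_Rabs, ex_series_Rabs_div_pow2; intros k.
  apply Rabs_le, SIN_bound. }
assert (Hc' : ex_series (fun k => w k * tc k)) by (eexists; exact Hc).
assert (E1 : forall k, Re (RtoC (weight dyadic_graph (Z.of_nat k)) *
  expi2 (IZR (Z.of_nat k) * theta))%C = w k * tc k).
{ intros k; simpl; rewrite <- INR_IZR_INZ; unfold w, tc; ring. }
assert (E2 : forall k, Im (RtoC (weight dyadic_graph (Z.of_nat k)) *
  expi2 (IZR (Z.of_nat k) * theta))%C = w k * ts k).
{ intros k; simpl; rewrite <- INR_IZR_INZ; unfold w, ts; ring. }
assert (E3 : forall k, Re (RtoC (weight dyadic_graph (- Z.of_nat k)) *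
  expi2 (IZR (- Z.of_nat k) * theta))%C = w k * tc k).
{ intros k; simpl; rewrite opp_IZR, <- INR_IZR_INZ, dyadic_weight_sym.
  unfold w, tc.
  replace (2 * PI * (- INR k * theta)) with (- (2 * PI * (INR k * theta))) by ring.
  rewrite cos_neg; ring. }
assert (E4 : forall k, Im (RtoC (weight dyadic_graph (- Z.of_nat k)) *
  expi2 (IZR (- Z.of_nat k) * theta))%C = - (w k * ts k)).
{ intros k; simpl; rewrite opp_IZR, <- INR_IZR_INZ, dyadic_weight_sym.
  unfold w, ts.
  replace (2 * PI * (- INR k * theta)) with (- (2 * PI * (INR k * theta))) by ring.
  rewrite sin_neg; ring. }
unfold floquet_eigenvalue, SeriesZ, SeriesC.
rewrite (Series_ext _ _ E1), (Series_ext _ _ E2).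
rewrite (Series_ext _ _ (fun k => E3 (S k))), (Series_ext _ _ (fun k => E4 (S k))).
rewrite Series_opp, !Htail, (is_series_unique _ _ Hc) by assumption.
unfold Cplus, RtoC; simpl; f_equal; field.
Qed.

(** * Self-similarity, periodicity and continuity of the lacunary series *)

Lemma lacunary_cos_doubling (x : R) :
  lacunary_cos x = cos (2 * PI * x) + lacunary_cos (2 * x) / 2.
Proof.
unfold lacunary_cos; rewrite Series_incr_1.
2: { apply ex_series_Rabs, ex_series_Rabs_div_pow2; intros m; apply Rabs_cos_le_1. }
f_equal.
- simpl; rewrite Rmult_1_l; field.
- unfold Rdiv at 2; rewrite <- Series_scal_r; apply Series_ext; intros m; simpl.
  replace (2 * 2 ^ m * x) with (2 ^ m * (2 * x)) by ring.
  field; apply pow_nonzero; lra.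
Qed.

Lemma lacunary_cos_bound (x : R) : Rabs (lacunary_cos x) <= 2.
Proof.
replace 2 with (/ (1 - / 2)) by field.
rewrite <- Series_geom by (rewrite Rabs_pos_eq; lra).
eapply Rle_trans; [apply Series_Rabs |].
- apply ex_series_Rabs_div_pow2; intros m; apply Rabs_cos_le_1.
- apply Series_le; [| apply ex_series_inv_pow2].
  intros m; split; [apply Rabs_pos |].
  apply Rabs_div_pow2_le, Rabs_cos_le_1.
Qed.

Lemma lacunary_cos_plus_INR (x : R) (n : nat) :
  lacunary_cos (x + INR n) = lacunary_cos x.
Proof.
apply Series_ext; intros m; f_equal.
replace (2 * PI * (2 ^ m * (x + INR n)))
  with (2 * PI * (2 ^ m * x) + 2 * INR (2 ^ m * n) * PI); [apply cos_period |].
rewrite mult_INR, pow_INR; change (INR 2) with 2; ring.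
Qed.

Fixpoint lacunary_partial (N : nat) (x : R) : R :=
  match N with
  | O => 0
  | S n => lacunary_partial n x + cos (2 * PI * (2 ^ n * x)) / 2 ^ n
  end.

(** Iterating the doubling identity shows the tail to be a rescaled copy of the function itself. Its
    bound then controls the tail for continuity, and its period 1 removes the tail from the
    differences. *)
Lemma lacunary_cos_partial (N : nat) (x : R) :
  lacunary_cos x = lacunary_partial N x + lacunary_cos (2 ^ N * x) / 2 ^ N.
Proof.
induction N as [|N IH]; simpl.
- rewrite Rmult_1_l; field.
- rewrite IH, (lacunary_cos_doubling (2 ^ N * x)).
  replace (2 * (2 ^ N * x)) with (2 * 2 ^ N * x) by ring.
  field; apply pow_nonzero; lra.
Qed.

Lemma continuity_pt_lacunary_partial (N : nat) (x : R) :
  continuity_pt (lacunary_partial N) x.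
Proof.
induction N as [|N IH]; simpl.
- now apply continuity_pt_const.
- apply continuity_pt_plus with (1 := IH); apply continuity_pt_filterlim.
  apply (ex_derive_continuous (fun y => cos (2 * PI * (2 ^ N * y)) / 2 ^ N)).
  auto_derive; exact I.
Qed.

Lemma continuous_lacunary_cos (x : R) : continuous lacunary_cos x.
Proof.
apply continuity_pt_filterlim; intros eps Heps.
(* Each of the two tails is at most 2 / 2^N < eps / 4, which leaves eps / 2 for the partial sums. *)
destruct (pow_lt_1_zero (/ 2)) with (y := eps / 8) as [N HN];
  [rewrite Rabs_pos_eq; lra | lra |].
specialize (HN N (le_n N)).
rewrite Rabs_pos_eq, pow_inv in HN
  by (apply pow_le; lra).
destruct (continuity_pt_lacunary_partial N x (eps / 2)) as [d [Hd H]]; [lra |].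
exists d; split; [exact Hd |]; intros y Hy; specialize (H y Hy).
simpl in *; unfold R_dist in *.
rewrite (lacunary_cos_partial N y), (lacunary_cos_partial N x).
assert (By := lacunary_cos_bound (2 ^ N * y)).
assert (Bx := lacunary_cos_bound (2 ^ N * x)).
assert (H2 : 0 < / 2 ^ N) by (apply Rinv_0_lt_compat, pow_lt; lra).
apply Rabs_def2 in H; apply Rabs_le_between in By, Bx.
unfold Rdiv; apply Rabs_def1; nra.
Qed.

(** * Fourth differences and the near-recursion for the cosines *)

(** The central difference with coefficients 1, -4, 6, -4, 1, written as the second difference of
    step 2h minus four times that of step h. *)
Definition fourth_diff (f : R -> R) (x h : R) : R :=
  f (x + 2 * h) + f (x - 2 * h) - 2 * f x
  - 4 * (f (x + h) + f (x - h) - 2 * f x).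

(** The two second differences are -4 cos a sin(2t)^2 and -4 cos a sin(t)^2, and sin(2t)^2 = 4
    sin(t)^2 cos(t)^2. *)
Lemma cos_fourth_diff (a t : R) :
  fourth_diff cos a (2 * t) = 16 * cos a * sin t ^ 4.
Proof.
unfold fourth_diff; rewrite !cos_plus, !cos_minus.
rewrite (cos_2a_sin (2 * t)), (cos_2a_sin t), (sin_2a t).
assert (H : cos t * cos t = 1 - sin t * sin t)
  by (assert (H := sin2_cos2 t); unfold Rsqr in H; lra).
transitivity (16 * cos a * (sin t * sin t) * (1 - cos t * cos t));
  [| rewrite H]; ring.
Qed.

Lemma fourth_diff_partial_S (N : nat) (x h : R) :
  fourth_diff (lacunary_partial (S N)) x h
  = fourth_diff (lacunary_partial N) x h
    + 16 * cos (2 * PI * (2 ^ N * x)) * sin (PI * (2 ^ N * h)) ^ 4 / 2 ^ N.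
Proof.
rewrite <- cos_fourth_diff.
unfold fourth_diff; simpl.
replace (2 * PI * (2 ^ N * (x + 2 * h)))
  with (2 * PI * (2 ^ N * x) + 2 * (2 * (PI * (2 ^ N * h)))) by ring.
replace (2 * PI * (2 ^ N * (x - 2 * h)))
  with (2 * PI * (2 ^ N * x) - 2 * (2 * (PI * (2 ^ N * h)))) by ring.
replace (2 * PI * (2 ^ N * (x + h)))
  with (2 * PI * (2 ^ N * x) + 2 * (PI * (2 ^ N * h))) by ring.
replace (2 * PI * (2 ^ N * (x - h)))
  with (2 * PI * (2 ^ N * x) - 2 * (PI * (2 ^ N * h))) by ring.
field; apply pow_nonzero; lra.
Qed.

(* Every term omitted on the right has the step as a period. *)
Lemma fourth_diff_lacunary_cos (N : nat) (x : R) :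
  fourth_diff lacunary_cos x (/ 2 ^ N)
  = fourth_diff (lacunary_partial N) x (/ 2 ^ N).
Proof.
assert (HN : 2 ^ N <> 0) by (apply pow_nonzero; lra).
assert (Hm : forall y n, lacunary_cos (y - INR n) = lacunary_cos y).
{ intros y n; rewrite <- (lacunary_cos_plus_INR (y - INR n) n); f_equal; ring. }
unfold fourth_diff.
rewrite (lacunary_cos_partial N x), (lacunary_cos_partial N (x + 2 * / 2 ^ N)),
  (lacunary_cos_partial N (x - 2 * / 2 ^ N)),
  (lacunary_cos_partial N (x + / 2 ^ N)), (lacunary_cos_partial N (x - / 2 ^ N)).
replace (2 ^ N * (x + 2 * / 2 ^ N)) with (2 ^ N * x + INR 2)
  by (simpl INR; field; assumption).
replace (2 ^ N * (x - 2 * / 2 ^ N)) with (2 ^ N * x - INR 2)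
  by (simpl INR; field; assumption).
replace (2 ^ N * (x + / 2 ^ N)) with (2 ^ N * x + INR 1)
  by (simpl INR; field; assumption).
replace (2 ^ N * (x - / 2 ^ N)) with (2 ^ N * x - INR 1)
  by (simpl INR; field; assumption).
rewrite !Hm, !lacunary_cos_plus_INR; field; assumption.
Qed.

(** Here sin y <= 1/2 gives cos(y)^2 >= 3/4, so sin(2y)^4 = 16 sin(y)^4 cos(y)^4 is at least 9
    sin(y)^4. *)
Lemma sin_half_pow4 (y : R) :
  0 <= y <= / 2 -> 2 * sin y ^ 4 <= 2 / 9 * sin (2 * y) ^ 4.
Proof.
intros Hy.
assert (Hs : 0 <= sin y <= / 2).
{ split; [apply sin_ge_0; assert (H := PI2_1); lra |].
  destruct (Req_dec y 0) as [-> | H0]; [rewrite sin_0; lra |].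
  assert (H := sin_lt_x y); lra. }
assert (Hc : 3 / 4 <= cos y * cos y)
  by (assert (H := sin2_cos2 y); unfold Rsqr in H; nra).
rewrite sin_2a.
replace ((2 * sin y * cos y) ^ 4)
  with (16 * sin y ^ 4 * (cos y * cos y) ^ 2) by ring.
assert (0 <= sin y ^ 4) by (apply pow_le; lra).
assert (9 / 16 <= (cos y * cos y) ^ 2) by nra.
nra.
Qed.

(** The weight of index i = k + 2 equals 1 at i = 2. From there on each halving of the angle lands
    below PI / 8 <= 1/2, so [sin_half_pow4] applies. *)
Lemma sin_dyadic_pow4_le (k : nat) :
  2 ^ (k + 2) * sin (PI / 2 ^ (k + 2)) ^ 4 <= (2 / 9) ^ k.
Proof.
induction k as [|k IH].
- simpl Nat.add; replace (PI / 2 ^ 2) with (PI / 4) by (simpl; field).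
  rewrite sin_PI4; replace ((1 / sqrt 2) ^ 4) with ((/ (sqrt 2 * sqrt 2)) ^ 2)
    by (field; assert (H := sqrt_lt_R0 2); lra).
  rewrite sqrt_sqrt by lra; simpl; lra.
- assert (H2 : 0 < 2 ^ (k + 2)) by (apply pow_lt; lra).
  assert (H4 : 4 <= 2 ^ (k + 2)).
  { rewrite pow_add; assert (H := pow_R1_Rle 2 k); simpl; lra. }
  set (y := PI / 2 ^ (S k + 2)).
  assert (Hy : PI / 2 ^ (k + 2) = 2 * y) by (unfold y; simpl; field; lra).
  assert (Hyb : 0 <= y <= / 2).
  { assert (Hpi := PI_4); assert (Hpi0 := PI_RGT_0).
    assert (y * 2 ^ (k + 2) = PI / 2) by (unfold y; simpl; field; lra).
    split; nra. }
  assert (Hs := sin_half_pow4 y Hyb).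
  rewrite Hy in IH; simpl; nra.
Qed.

(** The frequencies below N carry the weights of index at least k + 3, and 32/7 (2/9)^k is 16 times
    the geometric sum of (2/9)^j over j > k. *)
Lemma fourth_diff_partial_le (N k : nat) (x : R) :
  2 ^ (N + (k + 2)) * Rabs (fourth_diff (lacunary_partial N) x (/ 2 ^ (N + (k + 2))))
  <= 32 / 7 * (2 / 9) ^ k.
Proof.
revert k; induction N as [|N IH]; intros k.
- assert (H : 0 < (2 / 9) ^ k) by (apply pow_lt; lra).
  unfold fourth_diff; simpl lacunary_partial.
  replace (0 + 0 - 2 * 0 - 4 * (0 + 0 - 2 * 0)) with 0 by ring.
  rewrite Rabs_R0; lra.
- rewrite fourth_diff_partial_S.
  (* Removing the top frequency keeps the step fixed, so k grows as N decreases. *)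
  specialize (IH (S k)).
  replace (S N + (k + 2))%nat with (N + (S k + 2))%nat by lia.
  assert (Hs := sin_dyadic_pow4_le (S k)).
  assert (H1 : 0 < 2 ^ N) by (apply pow_lt; lra).
  assert (H2 : 0 < 2 ^ (S k + 2)) by (apply pow_lt; lra).
  set (M := (S k + 2)%nat) in *.
  replace (PI * (2 ^ N * / 2 ^ (N + M))) with (PI / 2 ^ M)
    by (rewrite pow_add; field; lra).
  set (c := cos _) in *; set (s := sin _ ^ 4) in *.
  set (D := fourth_diff _ _ _) in *.
  assert (Hs0 : 0 <= s).
  { unfold s; replace 4%nat with (2 * 2)%nat by reflexivity.
    rewrite pow_mult; apply pow2_ge_0. }
  assert (Hc : Rabs c <= 1) by apply Rabs_cos_le_1.
  apply Rle_trans with (2 ^ (N + M) * Rabs D + 16 * (2 ^ M * s)).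
  + apply Rle_trans with (2 ^ (N + M) * (Rabs D + 16 * s / 2 ^ N)).
    * apply Rmult_le_compat_l; [rewrite pow_add; nra |].
      eapply Rle_trans; [apply Rabs_triang |].
      apply Rplus_le_compat_l.
      replace (16 * c * s / 2 ^ N) with (c * (16 * s / 2 ^ N)) by (field; lra).
      assert (0 <= 16 * s / 2 ^ N).
      { unfold Rdiv; apply Rmult_le_pos; [lra |].
        apply Rlt_le, Rinv_0_lt_compat; lra. }
      rewrite Rabs_mult, (Rabs_pos_eq (16 * s / 2 ^ N)) by assumption; nra.
    * right; rewrite pow_add; field; lra.
  + simpl pow in IH, Hs |- *; lra.
Qed.

(** With step 2^-(N+2), the two highest frequencies have weights 2 and 1; the others contribute at
    most (32/7)/16 = 2/7 after division by 16. *)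
Lemma cos_recursion_le (N : nat) (x : R) :
  Rabs (cos (2 * PI * (2 ^ N * x)) + 2 * cos (2 * PI * (2 ^ (N + 1) * x)))
  <= 2 / 7
     + 2 ^ (N + 2) * Rabs (fourth_diff lacunary_cos x (/ 2 ^ (N + 2))) / 16.
Proof.
rewrite fourth_diff_lacunary_cos.
assert (HT := fourth_diff_partial_le N 0 x); simpl Nat.add in HT.
replace (N + 1)%nat with (S N) by lia.
replace (lacunary_partial (N + 2)) with (lacunary_partial (S (S N)))
  by (f_equal; lia).
rewrite !fourth_diff_partial_S.
assert (H1 : 0 < 2 ^ N) by (apply pow_lt; lra).
rewrite !pow_add in *.
replace (PI * (2 ^ N * / (2 ^ N * 2 ^ 2))) with (PI / 4) by (simpl; field; lra).
replace (PI * (2 ^ S N * / (2 ^ N * 2 ^ 2))) with (PI / 2) by (simpl; field; lra).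
rewrite sin_PI2, sin_PI4.
replace ((1 / sqrt 2) ^ 4) with ((/ (sqrt 2 * sqrt 2)) ^ 2)
  by (field; assert (H := sqrt_lt_R0 2); lra).
rewrite sqrt_sqrt by lra.
set (D := fourth_diff _ _ _) in *.
set (c := cos _); set (c' := cos _).
set (E := D + _ + _).
assert (HE : c + 2 * c' = (2 ^ N * 2 ^ 2) * E / 16 - (2 ^ N * 2 ^ 2) * D / 16)
  by (unfold E; simpl; field; lra).
assert (HP : 0 < 2 ^ N * 2 ^ 2) by (simpl; lra).
rewrite HE; eapply Rle_trans; [apply Rabs_triang |].
rewrite Rabs_Ropp; unfold Rdiv.
rewrite !Rabs_mult, (Rabs_pos_eq (/ 16)), (Rabs_pos_eq (2 ^ N)),
  (Rabs_pos_eq (2 ^ 2)) by lra.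
simpl pow in *; lra.
Qed.

(** * Contradiction with differentiability, and the final theorem *)

(** The affine part of [f] at [x] cancels. The remainders at offsets 2h, -2h, h, -h, weighted by 1,
    1, 4, 4, add up to 12h times eps / 12. *)
Lemma fourth_diff_derivable (f : R -> R) (x l eps : R) :
  derivable_pt_lim f x l -> 0 < eps ->
  exists d : posreal, forall h, 0 < h < d ->
    Rabs (fourth_diff f x h) <= eps * h.
Proof.
intros Hf Heps; destruct (Hf (eps / 12)) as [d Hd]; [lra |].
assert (Hd2 : 0 < d / 2) by (destruct d; simpl; lra).
exists (mkposreal _ Hd2); simpl; intros h Hh.
assert (Hr : forall u, u <> 0 -> Rabs u < d ->
  Rabs (f (x + u) - f x - l * u) <= eps / 12 * Rabs u).
{ intros u Hu Hud; specialize (Hd u Hu Hud).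
  replace (f (x + u) - f x - l * u) with (((f (x + u) - f x) / u - l) * u)
    by (field; exact Hu).
  rewrite Rabs_mult; assert (H := Rabs_pos u); nra. }
assert (R1 := Hr h); assert (R2 := Hr (- h)).
assert (R3 := Hr (2 * h)); assert (R4 := Hr (- (2 * h))).
rewrite Rabs_Ropp, Rabs_pos_eq in R2, R4 by lra.
rewrite (Rabs_pos_eq h) in R1 by lra.
rewrite (Rabs_pos_eq (2 * h)) in R3 by lra.
specialize (R1 ltac:(lra) ltac:(lra)); specialize (R2 ltac:(lra) ltac:(lra)).
specialize (R3 ltac:(lra) ltac:(lra)); specialize (R4 ltac:(lra) ltac:(lra)).
apply Rabs_le_between in R1, R2, R3, R4.
unfold fourth_diff; unfold Rminus in *.
apply Rabs_le; split; lra.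
Qed.

Lemma lacunary_cos_not_derivable (x l : R) : ~ derivable_pt_lim lacunary_cos x l.
Proof.
intros Hl.
destruct (fourth_diff_derivable _ _ _ (/ 2) Hl) as [d Hd]; [lra |].
destruct (pow_lt_1_zero (/ 2)) with (y := pos d) as [N HN];
  [rewrite Rabs_pos_eq; lra | apply cond_pos |].
set (c := fun n => cos (2 * PI * (2 ^ n * x))).
(* The term 1/32 is the chosen tolerance 1/2 divided by 16. *)
assert (HA : forall n, (N <= n)%nat -> Rabs (c n + 2 * c (n + 1)%nat) <= 2 / 7 + / 32).
{ intros n Hn; assert (H := cos_recursion_le n x).
  assert (HP : 0 < 2 ^ (n + 2)) by (apply pow_lt; lra).
  specialize (HN (n + 2)%nat ltac:(lia)).
  rewrite Rabs_pos_eq, pow_inv in HN by (apply pow_le; lra).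
  specialize (Hd (/ 2 ^ (n + 2)) (conj (Rinv_0_lt_compat _ HP) HN)).
  apply (Rmult_le_compat_l (2 ^ (n + 2))) in Hd; [| lra].
  replace (2 ^ (n + 2) * (/ 2 * / 2 ^ (n + 2))) with (/ 2) in Hd by (field; lra).
  unfold c; lra. }
(* Two applications suffice: starting from the bound 1, the first gives about 0.66 and the second
   about 0.49. *)
assert (Hb : forall n, (N + 2 <= n)%nat -> Rabs (c n) < / 2).
{ intros n Hn; destruct n as [|[|n]]; [lia | lia |].
  assert (A1 := HA n ltac:(lia)); assert (A2 := HA (n + 1)%nat ltac:(lia)).
  replace (n + 1 + 1)%nat with (S (S n)) in A2 by lia.
  assert (A0 : Rabs (c n) <= 1) by apply Rabs_cos_le_1.
  apply Rabs_le_between in A0, A1, A2; apply Rabs_def1; lra. }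
assert (B0 := Hb (N + 2)%nat ltac:(lia)); assert (B1 := Hb (S (N + 2)) ltac:(lia)).
assert (Hdup : c (S (N + 2)) = 2 * c (N + 2)%nat * c (N + 2)%nat - 1).
{ unfold c; rewrite <- cos_2a_cos; f_equal; simpl; ring. }
(* A value below 1/2 in modulus doubles to one below -1/2. *)
apply Rabs_def2 in B0, B1; nra.
Qed.

Theorem proposition5p1 :
  (forall theta : R, continuous (floquet_eigenvalue dyadic_graph) theta) /\
  (forall theta : R,
     ~ @ex_derive R_AbsRing C_R_NormedModule (floquet_eigenvalue dyadic_graph) theta).
Proof.
split; intros theta.
- apply continuous_ext with (f := fun t => RtoC (/ 2 * lacunary_cos t)).
  { intros t; symmetry; apply floquet_dyadic_graph. }
  intros P [eps HP].
  assert (H : continuous (fun t => / 2 * lacunary_cos t) theta)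
    by apply (continuous_scal_r (/ 2) lacunary_cos), continuous_lacunary_cos.
  destruct (H _ (locally_ball _ eps)) as [d Hd].
  exists d; intros y Hy; apply HP; split; [exact (Hd y Hy) | apply ball_center].
- intros [l Hl].
  (* Taking real parts is linear, so a complex derivative [l] would yield a real one; the factor 2
     undoes the 1/2 in the eigenvalue function. *)
  apply (lacunary_cos_not_derivable theta (2 * fst l)), is_derive_Reals.
  apply is_derive_ext with (f := fun t => 2 * fst (floquet_eigenvalue dyadic_graph t)).
  { intros t; rewrite floquet_dyadic_graph; simpl; field. }
  apply (is_derive_scal (fun t => fst (floquet_eigenvalue dyadic_graph t))).
  apply (filterdiff_comp' (V := C_R_NormedModule) (floquet_eigenvalue dyadic_graph) fst
    theta _ fst Hl).
  apply (filterdiff_linear (U := C_R_NormedModule)), is_linear_fst.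
Qed.
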